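(* Let $k\ge1$ be a fixed integer. Let $\mathcal{C}_{DHRSD}$, $\mathcal{C}_{DSD}$ and $\mathcal{C}_{DHID}$ denote, respectively, the classes of discrete Harris-randomly self-decomposable, discrete self-decomposable and discrete Harris-infinitely divisible distributions on $\mathbf{Z_+}=\{0,1,2,\dots\}$, identified with their probability generating functions (definitions in the context, all with this same $k$). Then $$\mathcal{C}_{DHRSD}=\mathcal{C}_{DSD}\cap\mathcal{C}_{DHID}.$$ Further, whenever the probability generating function $P$ belongs to $\mathcal{C}_{DHRSD}$, for every $c\in(0,1]$ and $p\in[0,1)$ the probability generating function $P_{c,p}$ in the defining relation $$P(s)=P_{c,p}(s)\,\{p+(1-p)P^{k}(1-c+cs)\}^{1/k},\qquad s\in[0,1],$$ can be written as $$P_{c,p}(s)=P_c(s)\,P_p(1-c+cs),\qquad s\in[0,1],$$ where $$P_c(s)=\frac{P(s)}{P(1-c+cs)},\qquad P_p(s)=\frac{P(s)}{\{p+(1-p)P^{k}(s)\}^{1/k}}.$$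
   Context: PGF means the probability generating function $P(s)=\sum_{n\ge0}\Pr(X=n)s^n$, $s\in[0,1]$, of a probability distribution on $\mathbf{Z_+}=\{0,1,2,\dots\}$; $P^k(s)=(P(s))^k$. Fix an integer $k\ge1$. All $k$-th roots are non-negative real roots. Discrete self-decomposable (DSD, in the sense of Steutel and van Harn): a PGF $P$ is DSD if for each $c\in(0,1]$ there exists a PGF $P_c$ such that $P(s)=P(1-c+cs)P_c(s)$ for all $s\in[0,1]$ (the case $c=1$ being trivial). Discrete Harris-infinitely divisible (DHID): a PGF $P$ is DHID if for each $p\in(0,1)$ there exists a PGF $P_p$ such that, with $a=1/p$, $$P(s)=\frac{P_p(s)}{\{a-(a-1)P_p^{k}(s)\}^{1/k}}\quad\text{for all }s\in[0,1].$$ Discrete Harris-randomly self-decomposable (DHRSD): a PGF $P$ is DHRSD if for each $c\in(0,1]$ and $p\in[0,1)$ there exists a PGF $P_{c,p}$ such that $$P(s)=P_{c,p}(s)\{p+(1-p)P^{k}(1-c+cs)\}^{1/k}\quad\text{for all }s\in[0,1].$$ *)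

(* Defs.v *)
From HB Require Import structures.
From mathcomp Require Import all_boot all_order all_algebra.
From mathcomp Require Import all_classical all_reals all_analysis.
Set Implicit Arguments.
Unset Strict Implicit.
Unset Printing Implicit Defensive.
Import Order.TTheory GRing.Theory Num.Theory.
Import numFieldNormedType.Exports.
Local Open Scope classical_set_scope.
Local Open Scope ring_scope.

Definition pgf (R : realType) (P : probability nat R) (s : R) : R :=
  limn [series fine (P [set n]) * s ^+ n]_n.

(* The non-negative [k]-th root; it is only ever used with [0 < k] and
   [0 <= x], where [x `^ k%:R^-1] is that root (in particular 0 at [x = 0]). *)
Definition kroot (R : realType) (k : nat) (x : R) : R := x `^ k%:R^-1.

(* The classes are sets of distributions on nat, each distribution standing
   for its probability generating function. *)

Definition DSD (R : realType) : set (probability nat R) :=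
  [set P | forall c : R, 0 < c <= 1 ->
    exists Pc : probability nat R, forall s : R, 0 <= s <= 1 ->
      pgf P s = pgf P (1 - c + c * s) * pgf Pc s].

Definition DHID (R : realType) (k : nat) : set (probability nat R) :=
  [set P | forall p : R, 0 < p < 1 ->
    exists Pp : probability nat R, forall s : R, 0 <= s <= 1 ->
      let a := p^-1 in
      pgf P s = pgf Pp s / kroot k (a - (a - 1) * pgf Pp s ^+ k)].

Definition DHRSD_factor (R : realType) (k : nat) (P : probability nat R)
    (c p : R) (Pcp : probability nat R) : Prop :=
  forall s : R, 0 <= s <= 1 ->
    pgf P s = pgf Pcp s * kroot k (p + (1 - p) * pgf P (1 - c + c * s) ^+ k).

Definition DHRSD (R : realType) (k : nat) : set (probability nat R) :=
  [set P | forall c p : R, 0 < c <= 1 -> 0 <= p < 1 ->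
    exists Pcp : probability nat R, DHRSD_factor k P c p Pcp].

(* Main.v *)
Require Import Defs.
From HB Require Import structures.
From mathcomp Require Import all_boot all_order all_algebra.
From mathcomp Require Import all_classical all_reals all_analysis.
From mathcomp Require Import ring lra.
Import Order.TTheory GRing.Theory Num.Theory.
Import numFieldNormedType.Exports.
Local Open Scope classical_set_scope.
Local Open Scope ring_scope.
Set Implicit Arguments.
Unset Strict Implicit.

(** Write t = 1 - c + c s.  The DHRSD relation contains both other relations
    as special cases: p = 0 turns it into P(s) = Pc(s) P(t), which is
    discrete self-decomposability, and c = 1 turns it into
    P = Q (p + (1 - p) P^k)^(1/k), which solved for P is the DHID relation
    P = Q / (a - (a - 1) Q^k)^(1/k) with a = 1/p ([harris_inverse]).

    Conversely, substituting the DHID relation at t into the DSD relation gives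
    P(s) = Pc(s) Pp(t) (p + (1 - p) P(t)^k)^(1/k), so it is enough that
    s |-> Pc(s) Pp(t) is the generating function of a distribution.  It is:
    composing with s |-> 1 - c + c s is binomial thinning ([pgf_thinning]) and
    multiplying generating functions is adding independent variables
    ([pgf_mul]).  Both distributions are mixtures, so both come from one
    computation, that the generating function of a mixture is the average of
    the generating functions of its components ([pgf_mixture]).

    The closed form of the factor is then a cancellation, legitimate as soon as
    P(t) <> 0.  Only t = 0, that is c = 1 and s = 0, needs an argument: a
    self-decomposable distribution has an atom at 0 ([DSD_pgf0_neq0]). *)

(** * Generating functions as expectations *)

Section expectation.
Variable R : realType.
Implicit Types P Q : probability nat R.

Lemma fineK_pmf P n : (fine (P [set n]))%:E = P [set n].
Proof. by rewrite fineK// fin_num_measure. Qed.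

Lemma ge0_integral_nat P (f : nat -> \bar R) : (forall n, 0 <= f n)%E ->
  (\int[P]_n f n = \sum_(n <oo) P [set n] * f n)%E.
Proof.
move=> f0.
have UT : \bigcup_(n in [set: nat]) [set n] = [set: nat].
  by apply/seteqP; split=> n // _; exists n.
rewrite -[X in integral _ X _]UT ge0_integral_bigcup //.
- apply: eq_eseriesr => n _.
  rewrite (eq_integral (cst (f n))); last by move=> m /[!inE] ->.
  by rewrite integral_cst// muleC.
- by apply/trivIsetP => i j _ _ ij; apply/seteqP; split=> n //= [-> /eqP];
    rewrite (negbTE ij).
Qed.

Lemma integral_prob_cst P (r : R) : (\int[P]_n r%:E = r%:E)%E.
Proof. by rewrite (integral_cst P)//= probability_setT mule1. Qed.

(** Turns the limit of partial sums into an integral; all later facts on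
    generating functions follow from properties of the integral. *)
Lemma pgfE P s : 0 <= s <= 1 -> (pgf P s)%:E = (\int[P]_n (s ^+ n)%:E)%E.
Proof.
move=> /andP[s0 s1].
have term0 n : 0 <= fine (P [set n]) * s ^+ n.
  by rewrite mulr_ge0 ?fine_ge0 ?exprn_ge0.
have E : (\int[P]_n (s ^+ n)%:E =
          \sum_(n <oo) (fine (P [set n]) * s ^+ n)%:E)%E.
  rewrite ge0_integral_nat; last by move=> n; rewrite lee_fin exprn_ge0.
  by apply: eq_eseriesr => n _; rewrite EFinM fineK_pmf.
have cvgP : cvgn [series fine (P [set n]) * s ^+ n]_n.
  apply: nnseries_is_cvg => //; rewrite -E.
  apply: (@le_lt_trans _ _ (\int[P]_n 1)%E); last first.
    by rewrite integral_prob_cst ltry.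
  by apply: ge0_le_integral => // n _; rewrite lee_fin ?exprn_ge0 ?exprn_ile1.
rewrite E /pgf -EFin_lim//; congr (limn _); apply/funext => n /=.
by rewrite /series/= sumEFin.
Qed.

Lemma pgf_dirac m (s : R) : 0 <= s <= 1 ->
  pgf (@dirac _ _ m R : probability nat R) s = s ^+ m.
Proof.
move=> s01; apply: EFin_inj.
by rewrite pgfE// integral_dirac// diracT mul1e.
Qed.

Lemma pgf_binomial m (c s : R) : 0 <= c <= 1 -> 0 <= s <= 1 ->
  pgf (binomial_prob m c) s = (1 - c + c * s) ^+ m.
Proof.
move=> /andP[c0 c1] s01; apply: EFin_inj; rewrite pgfE//.
have /andP[s0 s1] := s01.
rewrite (@integral_binomial _ m c c0 c1); last first.
  by move=> n; rewrite lee_fin exprn_ge0.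
rewrite exprDn -sumEFin; apply: eq_bigr => i _ /=.
by rewrite -EFinM exprMn mulrnAl; congr ((_ *+ _)%:E); ring.
Qed.

End expectation.

(** * Mixtures *)

Section mixture.
Variable R : realType.
Variables (w : probability nat R) (Q : nat -> probability nat R).

Definition mixture : set nat -> \bar R :=
  mseries (fun n => mscale (NngNum (fine_ge0 (measure_ge0 w [set n]))) (Q n)) 0.

HB.instance Definition _ := Measure.on mixture.

Let ge0_integral_mixture (f : nat -> \bar R) : (forall n, 0 <= f n)%E ->
  (\int[mixture]_n f n = \int[w]_m \int[Q m]_n f n)%E.
Proof.
move=> f0; rewrite ge0_integral_measure_series//.
rewrite ge0_integral_nat; last by move=> m; exact: integral_ge0.
by apply: eq_eseriesr => n _; rewrite ge0_integral_mscale//= fineK_pmf.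
Qed.

Let mixture_setT : mixture [set: nat] = 1%E.
Proof.
rewrite -[LHS]mul1e -integral_cst// ge0_integral_mixture//.
under eq_integral do rewrite integral_prob_cst.
by rewrite integral_prob_cst.
Qed.

HB.instance Definition _ :=
  Measure_isProbability.Build _ _ R mixture mixture_setT.

Lemma pgf_mixture s : 0 <= s <= 1 ->
  (pgf mixture s)%:E = (\int[w]_n (pgf (Q n) s)%:E)%E.
Proof.
move=> s01; have /andP[s0 _] := s01.
rewrite pgfE// ge0_integral_mixture; last by move=> n; rewrite lee_fin exprn_ge0.
by apply: eq_integral => n _; rewrite pgfE.
Qed.

End mixture.

(** * Bounds on generating functions *)

Lemma thinning_itv (R : realFieldType) (c s : R) : 0 <= c <= 1 -> 0 <= s <= 1 ->
  0 <= 1 - c + c * s <= 1.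
Proof. by move=> /andP[c0 c1] /andP[s0 s1]; apply/andP; split; nra. Qed.

Section bounds.
Variable R : realType.
Implicit Types P : probability nat R.

Lemma pgf_ge0 P (s : R) : 0 <= s <= 1 -> 0 <= pgf P s.
Proof.
move=> s01; have /andP[s0 _] := s01; rewrite -lee_fin pgfE//.
by apply: integral_ge0 => n _; rewrite lee_fin exprn_ge0.
Qed.

Lemma pgf_le1 P (s : R) : 0 <= s <= 1 -> pgf P s <= 1.
Proof.
move=> s01; have /andP[s0 s1] := s01.
rewrite -lee_fin pgfE// -[leRHS](integral_prob_cst P).
by apply: ge0_le_integral => // n _; rewrite lee_fin ?exprn_ge0 ?exprn_ile1.
Qed.

Lemma pgf_ge_term P n (s : R) : 0 <= s <= 1 ->
  fine (P [set n]) * s ^+ n <= pgf P s.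
Proof.
move=> s01; have /andP[s0 s1] := s01.
have term0 m : (0 <= P [set m] * (s ^+ m)%:E)%E.
  by rewrite mule_ge0// lee_fin exprn_ge0.
rewrite -lee_fin EFinM fineK_pmf pgfE// ge0_integral_nat; last first.
  by move=> m; rewrite lee_fin exprn_ge0.
apply: le_trans (nneseries_lim_ge n.+1 _); last by move=> m _ _; exact: term0.
by rewrite big_nat_recr//= leeDr// sume_ge0.
Qed.

(** Some n is an atom of P, and a single term of the series already bounds it
    below. *)
Lemma pgf_gt0 P (s : R) : 0 < s <= 1 -> 0 < pgf P s.
Proof.
move=> /andP[s0 s1]; have s01 : 0 <= s <= 1 by rewrite ltW.
have [[n Pn]|P0] := pselect (exists n, fine (P [set n]) != 0).
  apply: lt_le_trans (pgf_ge_term P n s01).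
  by rewrite mulr_gt0 ?exprn_gt0// lt_neqAle eq_sym Pn fine_ge0.
have : (\int[P]_n 1%:E = 0)%E.
  rewrite ge0_integral_nat// eseries0// => n _ _ /=.
  rewrite -fineK_pmf; have [->|nz] := eqVneq (fine (P [set n])) 0.
    by rewrite mul0e.
  by case: P0; exists n.
by rewrite integral_prob_cst => /eqP; rewrite onee_eq0.
Qed.

(** There is no mass at 0, and s ^ n <= s for the remaining n >= 1. *)
Lemma pgf0_le_id P (s : R) : pgf P 0 = 0 -> 0 <= s <= 1 -> pgf P s <= s.
Proof.
move=> P0 s01; have /andP[s0 s1] := s01.
have p0 : P [set 0%N] = 0%E.
  rewrite -fineK_pmf; congr EFin; apply/eqP; rewrite eq_le fine_ge0// andbT.
  by have := @pgf_ge_term P 0 0; rewrite P0 expr0 mulr1; apply; rewrite lexx ler01.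
rewrite -lee_fin pgfE// -[leRHS](integral_prob_cst P).
rewrite !ge0_integral_nat//; last by move=> n; rewrite lee_fin exprn_ge0.
apply: lee_nneseries => [n _ _|[|n] _]; first by rewrite mule_ge0// lee_fin exprn_ge0.
  by rewrite p0 !mul0e.
by rewrite lee_pmul// ?lee_fin ?exprn_ge0// exprS ler_piMr// exprn_ile1.
Qed.

Lemma exprn_chord (c s : R) n : 0 <= c <= 1 -> 0 <= s <= 1 ->
  (1 - c + c * s) ^+ n <= 1 - c + c * s ^+ n.
Proof.
move=> c01 s01; have /andP[t0 _] := thinning_itv c01 s01.
have /andP[c0 c1] := c01; have /andP[s0 s1] := s01.
elim: n => [|n IHn]; first by rewrite !expr0 mulr1 subrK.
rewrite exprS; apply: le_trans (ler_wpM2l t0 IHn) _; rewrite -subr_ge0 exprS.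
have -> : 1 - c + c * (s * s ^+ n) - (1 - c + c * s) * (1 - c + c * s ^+ n) =
  c * (1 - c) * ((1 - s) * (1 - s ^+ n)) by ring.
by rewrite !mulr_ge0// subr_ge0// exprn_ile1.
Qed.

(** This is convexity on the chord from s to 1, where P takes the value 1; it
    serves as a quantitative form of the continuity of P as c tends to 1. *)
Lemma pgf_chord P (c s : R) : 0 <= c <= 1 -> 0 <= s <= 1 ->
  pgf P (1 - c + c * s) <= 1 - c + c * pgf P s.
Proof.
move=> c01 s01; have t01 := thinning_itv c01 s01.
have /andP[c0 c1] := c01; have /andP[s0 s1] := s01; have /andP[t0 _] := t01.
have c1' : 0 <= 1 - c by rewrite subr_ge0.
rewrite -lee_fin EFinD EFinM !pgfE// -(integral_prob_cst P (1 - c)).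
rewrite -ge0_integralZl_EFin//; last by move=> n _; rewrite lee_fin exprn_ge0.
rewrite -ge0_integralD//; last by move=> n _; rewrite -EFinM lee_fin mulr_ge0 ?exprn_ge0.
apply: ge0_le_integral => //= n _; rewrite -?EFinM -?EFinD lee_fin.
- by rewrite exprn_ge0.
- exact: exprn_chord.
Qed.

End bounds.

(** * Products and thinnings of generating functions *)

Section operations.
Variable R : realType.
Implicit Types P Q : probability nat R.

(** The convolution of P and Q is the P-mixture of the translates of Q, and the
    translate of Q by n is itself the Q-mixture of the Dirac masses at n + m. *)
Lemma pgf_mul P Q : exists M : probability nat R,
  forall s : R, 0 <= s <= 1 -> pgf M s = pgf P s * pgf Q s.
Proof.
pose shift n : probability nat R := mixture Q (fun m => \d_(n + m)%N).
exists (mixture P shift) => s s01; have /andP[s0 s1] := s01.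
have pgf_shift n : (pgf (shift n) s)%:E = ((pgf Q s)%:E * (s ^+ n)%:E)%E.
  rewrite pgf_mixture// pgfE// muleC -ge0_integralZl_EFin ?exprn_ge0//; last first.
    by move=> m _; rewrite lee_fin exprn_ge0.
  by apply: eq_integral => m _; rewrite pgf_dirac// exprD EFinM.
apply: EFin_inj; rewrite pgf_mixture// mulrC EFinM.
under eq_integral do rewrite pgf_shift.
rewrite ge0_integralZl_EFin ?pgf_ge0 -?pgfE//.
by move=> m _; rewrite lee_fin exprn_ge0.
Qed.

(** Keep each of n individuals with probability c, where n has law P: the
    binomial law has generating function (1 - c + c s) ^ n. *)
Lemma pgf_thinning P (c : R) : 0 <= c <= 1 -> exists M : probability nat R,
  forall s : R, 0 <= s <= 1 -> pgf M s = pgf P (1 - c + c * s).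
Proof.
move=> c01; exists (mixture P (fun n => binomial_prob n c)) => s s01.
apply: EFin_inj; rewrite pgf_mixture// pgfE ?thinning_itv//.
by apply: eq_integral => n _; rewrite pgf_binomial.
Qed.

End operations.

(** * The Harris relation *)

Section root.
Context (R : realType) (k : nat) (k_gt0 : (0 < k)%N).

Lemma kroot_expK (x : R) : 0 <= x -> kroot k (x ^+ k) = x.
Proof.
move=> x0; rewrite /kroot -powR_mulrn// -powRrM mulfV ?pnatr_eq0 -?lt0n//.
by rewrite powRr1.
Qed.

Lemma exp_krootK (x : R) : 0 <= x -> kroot k x ^+ k = x.
Proof.
move=> x0; rewrite /kroot -powR_mulrn ?powR_ge0// -powRrM.
by rewrite mulVf ?pnatr_eq0 -?lt0n// powRr1.
Qed.

Lemma kroot_gt0 (x : R) : 0 < x -> 0 < kroot k x.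
Proof. exact: powR_gt0. Qed.

(** With X = x^k and Y = y^k both equations are the same linear relation between
    X, Y and X Y: X (1/p - (1/p - 1) Y) = Y is X = Y (p + (1 - p) X) divided
    by p and rearranged.  The bounds on y and p keep both radicands positive,
    and taking k-th powers loses nothing on non-negative reals. *)
Lemma harris_inverse (p x y : R) : 0 < p < 1 -> 0 <= x -> 0 <= y <= 1 ->
  (x = y / kroot k (p^-1 - (p^-1 - 1) * y ^+ k)) <->
  (x = y * kroot k (p + (1 - p) * x ^+ k)).
Proof.
move=> /andP[p0 p1] x0 /andP[y0 y1].
have Y1 : y ^+ k <= 1 by rewrite exprn_ile1.
have D0 : 0 < p^-1 - (p^-1 - 1) * y ^+ k.
  have : 1 <= p^-1 by rewrite invf_ge1 ?ltW.
  by have := exprn_ge0 k y0; nra.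
have N0 : 0 < p + (1 - p) * x ^+ k.
  by rewrite ltr_pwDl// mulr_ge0 ?exprn_ge0// subr_ge0 ltW.
have eq_expn (z : R) : 0 <= z -> x = z <-> x ^+ k = z ^+ k.
  by move=> z0; split=> [->//|/(pexpIrn k_gt0)]; apply; rewrite nnegrE.
rewrite eq_expn ?divr_ge0 ?powR_ge0// [in X in _ <-> X]eq_expn ?mulr_ge0 ?powR_ge0//.
rewrite !exprMn exprVn !exp_krootK ?ltW//.
move: (x ^+ k) (y ^+ k) D0 => X Y D0.
have E : (X * (p^-1 - (p^-1 - 1) * Y) - Y) * p = X - Y * (p + (1 - p) * X).
  by field; rewrite gt_eqF.
split=> [XE|XE].
- apply/eqP; rewrite -subr_eq0 -E mulf_eq0 subr_eq0 [X in X * _]XE.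
  by rewrite divfK ?eqxx// gt_eqF.
- apply: (mulIf (lt0r_neq0 D0)); rewrite divfK ?gt_eqF//.
  apply/eqP; rewrite -subr_eq0; move/eqP: XE; rewrite -subr_eq0 -E mulf_eq0.
  by rewrite (gt_eqF p0) orbF.
Qed.

End root.

(** * Self-decomposable laws charge 0 *)

(** Suppose P(0) = 0.  At s = 0 the relation reads 0 = P(1 - c) Pc(0) with
    P(1 - c) > 0 when c < 1, so Pc(0) = 0 and hence Pc(s) <= s.  Thus
    P(s) <= s P(1 - c + c s) for every c < 1; letting c tend to 1 would give
    P(s) <= s P(s), impossible for 0 < s < 1. *)
Lemma DSD_pgf0_neq0 (R : realType) (P : probability nat R) :
  @DSD R P -> pgf P 0 != 0.
Proof.
move=> dsdP; apply/eqP => P0.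
have half01 : 0 <= (2^-1 : R) <= 1 by lra.
have P2_gt0 : 0 < pgf P 2^-1 by apply: pgf_gt0; lra.
have P2_le1 := pgf_le1 P half01.
(* At s = 1/2 the chord bound turns P(s) <= s P(1 - c + c s) into
   (2 - c) P(1/2) <= 1 - c, which fails when 1 - c is half of P(1/2). *)
pose c : R := 1 - pgf P 2^-1 / 2.
have c01 : 0 < c < 1 by rewrite /c; lra.
have c01' : 0 <= c <= 1 by lra.
have [Pc PcE] := dsdP c ltac:(lra).
have Pc0 : pgf Pc 0 = 0.
  have := PcE 0; rewrite lexx ler01 P0 mulr0 addr0 => /(_ isT)/esym/eqP.
  rewrite mulf_eq0 => /orP[/eqP Pc0|/eqP//].
  by have := @pgf_gt0 R P (1 - c) ltac:(lra); rewrite Pc0 ltxx.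
have t_ge0 := pgf_ge0 P (thinning_itv c01' half01).
have t_le := pgf_chord P c01' half01.
have Pc_le := pgf0_le_id Pc0 half01.
have := ler_wpM2l t_ge0 Pc_le; rewrite -PcE//.
have cE : c = 1 - pgf P 2^-1 / 2 by [].
by move: t_le; rewrite cE; nra.
Qed.

(** * The classes *)

Unset Implicit Arguments.
Set Strict Implicit.

Theorem proposition3p1 (R : realType) (k : nat) (hk : (1 <= k)%N) :
  @DHRSD R k = @DSD R `&` @DHID R k /\
  forall P : probability nat R, @DHRSD R k P ->
  forall c p : R, 0 < c <= 1 -> 0 <= p < 1 ->
  forall Pcp : probability nat R, DHRSD_factor k P c p Pcp ->
  let Pc_den (s : R) := pgf P (1 - c + c * s) in
  let Pp_den (s : R) := kroot k (p + (1 - p) * pgf P s ^+ k) in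
  let Pc (s : R) := pgf P s / Pc_den s in
  let Pp (s : R) := pgf P s / Pp_den s in
  forall s : R, 0 <= s <= 1 ->
    [/\ Pc_den s != 0, Pp_den (1 - c + c * s) != 0 &
        pgf Pcp s = Pc s * Pp (1 - c + c * s)].
Proof.
have k_gt0 : (0 < k)%N by [].
have DHRSD_DSD : @DHRSD R k `<=` @DSD R.
  move=> P dhrsdP c c01; have [||Q QE] := dhrsdP c 0 => //; first by lra.
  exists Q => s s01.
  have c01' : 0 <= c <= 1 by lra.
  rewrite QE// add0r subr0 mul1r kroot_expK//; first by rewrite mulrC.
  by rewrite pgf_ge0// thinning_itv.
split.
  apply/seteqP; split=> [P dhrsdP|P [dsdP dhidP] c p c01 p01].
    split; first exact: DHRSD_DSD.
    move=> p p01; have [||Q QE] := dhrsdP 1 p; [lra|lra|exists Q => s s01 /=].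
    have := QE s s01; rewrite subrr add0r mul1r => PE.
    by apply/harris_inverse => //; rewrite pgf_ge0 ?pgf_le1.
  have [Pc PcE] := dsdP c c01.
  have c01' : 0 <= c <= 1 by lra.
  have t01 s : 0 <= s <= 1 -> 0 <= 1 - c + c * s <= 1 by exact: thinning_itv.
  have [p0|p_neq0] := eqVneq p 0.
    exists Pc => s s01; rewrite p0 add0r subr0 mul1r kroot_expK ?pgf_ge0 ?t01//.
    by rewrite mulrC -PcE.
  have p01' : 0 < p < 1 by rewrite lt_neqAle eq_sym p_neq0.
  have [Pp PpE] := dhidP p p01'.
  have [M ME] := pgf_thinning Pp c01'.
  have [Pcp PcpE] := pgf_mul Pc M.
  exists Pcp => s s01; rewrite PcpE// ME// -mulrA PcE// [LHS]mulrC.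
  congr (_ * _); apply/(harris_inverse k_gt0) => //.
  - by rewrite pgf_ge0 ?t01.
  - by rewrite pgf_ge0 ?pgf_le1 ?t01.
  - exact/PpE/t01.
move=> P /DHRSD_DSD dsdP c p c01 p01 Pcp PcpE Pc_den Pp_den Pc Pp s s01.
have t01 : 0 <= 1 - c + c * s <= 1 by apply: thinning_itv => //; lra.
(* P is positive on (0, 1], which leaves t = 0, the atom of P at 0. *)
have Pt_gt0 : 0 < Pc_den s.
  have [t0|t_neq0] := eqVneq (1 - c + c * s) 0.
    by rewrite /Pc_den t0 lt_neqAle eq_sym DSD_pgf0_neq0// pgf_ge0// lexx ler01.
  by apply: pgf_gt0; rewrite lt_neqAle eq_sym t_neq0.
have Pp_gt0 : 0 < Pp_den (1 - c + c * s).
  apply: kroot_gt0; rewrite -/(Pc_den s); have := exprn_gt0 k Pt_gt0; nra.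
split; rewrite ?gt_eqF//.
rewrite /Pc /Pp mulrA divfK ?gt_eqF// (PcpE s s01) -/(Pp_den _).
by rewrite mulfK ?gt_eqF.
Qed.
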